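(* If the set of Wieferich primes is infinite, then the set $\mathcal{H}_\mu$ of $\mu$-hits is infinite.
   Context: A Wieferich prime is a prime $p$ such that $p^2$ divides $2^{p-1}-1$. The function $\mu:\mathbb{Z}_{\geq1}\to\mathbb{R}_{\geq 0}$ is defined by $\mu(q_1^{n_1}\cdots q_r^{n_r})=\log(q_1\cdots q_r)+\log(n_1\cdots n_r)$ for distinct primes $q_1,\ldots,q_r$ and positive integers $n_1,\ldots,n_r$ (natural logarithm; $\mu(1)=0$). $\mathcal{H}_\mu$ is the set of triples $(a,b,c)$ of positive integers with $a+b=c$, $\gcd(a,b)=1$ and $\log c>\mu(abc)$; its elements are called $\mu$-hits. *)

(* Defs.v *)
From mathcomp Require Import all_boot all_order all_algebra.
From mathcomp Require Import all_classical all_reals all_analysis.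

Set Implicit Arguments.
Unset Strict Implicit.
Unset Printing Implicit Defensive.

Import Order.TTheory GRing.Theory Num.Theory.
Local Open Scope ring_scope.
Local Open Scope classical_set_scope.

Definition wieferich : set nat :=
  [set p : nat | prime p /\ (p ^ 2 %| 2 ^ (p - 1) - 1)%N].

(* For n = q_1^n_1 ... q_r^n_r, [primes n] lists q_1, ..., q_r and
   [logn q_i n] is n_i. The value at n = 0 is irrelevant. *)
Definition mu (R : realType) (n : nat) : R :=
  ln ((\prod_(q <- primes n) q)%N%:R) + ln ((\prod_(q <- primes n) logn q n)%N%:R).

Definition mu_hits (R : realType) : set (nat * nat * nat) :=
  [set t : nat * nat * nat | let: (a, b, c) := t in
    [/\ [/\ (0 < a)%N, (0 < b)%N & (0 < c)%N],
        (a + b = c)%N,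
        gcdn a b = 1%N &
        mu R (a * b * c) < ln (c%:R : R)]].

(* Main.v *)
(* Take triples (1, M_n, 2^n) with M_n = 2^n - 1, and let rho(n) = n * prod_q v / q^(v-1),
   over the primes q with exponent v > 0 in M_n; rho(n) < 1/2 gives a hit, and replacing
   n by a multiple only changes the product by a factor <= 1.  We show that for 12 | n
   some multiple m of n has rho(m) <= rho(n) / 2.  Pick a Wieferich prime p > 2^n and
   replace n by n1 = lcm(n, p - 1): n grows by (p - 1) / d, d = gcd(n, p - 1) even, and
   p^2 | M_n1 saves a factor p / 2.  So d >= 4 suffices.  If d = 2, then p - 1 has a
   prime factor q > 3 not dividing n.  If q | M_n1, its exponent in M_n1 exceeds that
   in M_n, because q | n1, and is at least 2, which saves a further q / 2.  Otherwise
   repeat with (q, n1) in place of (p, n): as q | n1, q^2 divides M_lcm(n1, q - 1), just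
   as for a Wieferich prime.  Since q < p, this ends. *)
Require Import Defs.
From mathcomp Require Import all_boot all_order all_algebra.
From mathcomp Require Import all_classical all_reals all_analysis.
From mathcomp Require Import zify lra.

Set Implicit Arguments.
Unset Strict Implicit.
Unset Printing Implicit Defensive.

Import Order.TTheory GRing.Theory Num.Theory.
Local Open Scope ring_scope.

(** * Divisors of 2^n - 1 *)

Lemma dvdn_predX2 m n : (m %| n)%N -> ((2 ^ m).-1 %| (2 ^ n).-1)%N.
Proof. by case/dvdnP=> k ->; rewrite mulnC expnM dvdn_pred_predX. Qed.

Lemma predX2_gt0 n : (0 < n)%N -> (0 < (2 ^ n).-1)%N.
Proof. by move=> n0; rewrite -ltnS prednK ?expn_gt0 // -[1%N]/(2 ^ 0)%N ltn_exp2l. Qed.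

(** By Fermat, x = x^q = 1 mod q, so the cofactor 1 + x + ... + x^(q-1) is a sum of q terms
    congruent to 1, hence divisible by q. *)
Lemma prime_dvd_predX_lift q x : (0 < x)%N -> prime q -> (q %| (x ^ q).-1)%N ->
  (q %| x.-1)%N /\ (x.-1 * q %| (x ^ q).-1)%N.
Proof.
move=> x0 qP qx.
have x1 : x = 1 %[mod q].
  apply/eqP; rewrite -fermat_little // eqn_mod_dvd ?subn1 //.
  by rewrite expn_gt0 x0.
split; first by move/eqP: x1; rewrite eqn_mod_dvd // subn1.
rewrite predn_exp dvdn_mul // /dvdn -modn_summ.
rewrite (eq_bigr (fun=> 1 %% q)%N); last first.
  by move=> i _; rewrite -modnXm x1 modnXm exp1n.
by rewrite modn_summ sum1_card card_ord modnn.
Qed.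

(** Write n = k * m * q and lift from x = 2^(k*m). The second conclusion makes the exponent of q in
    2^n - 1 exceed that in 2^m - 1. *)
Lemma prime_dvd_predX2_lift q m n : prime q -> coprime q m ->
  (m %| n)%N -> (q %| n)%N -> (q %| (2 ^ n).-1)%N ->
  (q ^ 2 %| (2 ^ n).-1)%N /\ ((2 ^ m).-1 * q %| (2 ^ n).-1)%N.
Proof.
move=> qP qm mn qn; have : (m * q %| n)%N by rewrite Gauss_dvd ?mn // coprime_sym.
case/dvdnP=> k ->; rewrite mulnA expnM => qM.
have [qk qkM] := prime_dvd_predX_lift (expn_gt0 2 (k * m)) qP qM.
split; apply: dvdn_trans qkM; last by rewrite dvdn_mul // dvdn_predX2 // dvdn_mull.
by rewrite dvdn_mul.
Qed.

Lemma fermat_predX2 p n : prime p -> odd p -> (p.-1 %| n)%N -> (p %| (2 ^ n).-1)%N.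
Proof.
move=> pP po pn; apply: dvdn_trans (dvdn_predX2 pn).
have p2 : coprime p 2 by rewrite coprime_sym prime_coprime // dvdn2 po.
rewrite -(Gauss_dvdr _ p2) -subn1 mulnBr -expnS prednK ?prime_gt0 // muln1.
by rewrite -eqn_mod_dvd ?fermat_little // -[X in (X <= _)%N]expn1 leq_exp2l // prime_gt0.
Qed.

(** * Weights, defects and divisibility *)

(* A prime [q] of exponent [v > 0] in [m] contributes [q * v = q ^ v * weight q v]
   to the exponential of [mu m]. *)
Definition weight (R : realType) (q v : nat) : R :=
  (maxn v 1)%:R / q%:R ^+ v.-1.

Definition defect (R : realType) (m : nat) : R :=
  \prod_(q <- primes m) weight R q (logn q m).

Lemma weight_gt0 (R : realType) q v : (0 < q)%N -> 0 < weight R q v.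
Proof. by move=> q0; rewrite divr_gt0 ?exprn_gt0 ?ltr0n // leq_max orbT. Qed.

Lemma weight0 (R : realType) q : weight R q 0 = 1.
Proof. by rewrite /weight max0n expr0 divr1. Qed.

Lemma weightS (R : realType) q v : weight R q v.+1 = v.+1%:R / q%:R ^+ v.
Proof. by rewrite /weight (maxn_idPl _). Qed.

Lemma weight_nonincreasing (R : realType) q : (1 < q)%N ->
  {homo weight R q : v w / (v <= w)%N >-> w <= v}.
Proof.
move=> q1; apply: homo_leq => [x //|y x z xy yz|v]; first exact: le_trans yz xy.
case: v => [|v]; first by rewrite weight0 weightS expr0 divr1.
rewrite !weightS.
have q0 : 0 < q%:R :> R by rewrite ltr0n ltnW.
rewrite ler_pdivrMr ?exprn_gt0 // exprSr mulrA mulfVK ?gt_eqF ?exprn_gt0 //.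
by rewrite -natrM ler_nat; nia.
Qed.

Lemma weight_ge2 (R : realType) q v : (1 < q)%N -> (1 < v)%N ->
  weight R q v <= 2 / q%:R.
Proof.
by move=> q1 v2; rewrite (le_trans (weight_nonincreasing R q1 v2)) // weightS expr1.
Qed.

(** Raising an exponent v > 0 to v + 1 multiplies the weight by (v + 1) / (v * q) <= 2 / q. From 0
    to 1 nothing is gained, hence [1 < w]. *)
Lemma weight_succ (R : realType) q v w : (1 < q)%N -> (1 < w)%N -> (v < w)%N ->
  weight R q w <= 2 / q%:R * weight R q v.
Proof.
move=> q1 w1 vw; case: v vw => [|v] vw; first by rewrite weight0 mulr1 weight_ge2.
apply: le_trans (weight_nonincreasing R q1 vw) _.
rewrite !weightS exprS invfM mulrACA ler_pM2r; last first.
  by rewrite mulr_gt0 ?invr_gt0 ?exprn_gt0 ?ltr0n ?(ltnW q1).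
by rewrite -natrM ler_nat; lia.
Qed.

Lemma defect_gt0 (R : realType) m : 0 < defect R m.
Proof.
rewrite /defect big_seq; apply: prodr_gt0 => q.
by rewrite mem_primes => /and3P[qP _ _]; rewrite weight_gt0 ?prime_gt0.
Qed.

(** Since [maxn] gives exponent 0 the weight 1, the defects of m and of its multiple n become
    products over the same primes. *)
Lemma defect_primes (R : realType) m n : (m %| n)%N -> (0 < n)%N ->
  defect R m = \prod_(q <- primes n) weight R q (logn q m).
Proof.
move=> mn n0; rewrite [RHS](bigID (fun q => q \in primes m)) /=.
rewrite [X in _ * X]big1 ?mulr1; last first.
  by move=> q; rewrite -logn_gt0 lt0n negbK => /eqP ->; rewrite weight0.
rewrite -[RHS]big_filter; apply: perm_big; apply: uniq_perm.
- exact: primes_uniq.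
- by rewrite filter_uniq ?primes_uniq.
move=> q; rewrite mem_filter andb_idr // !mem_primes n0 => /and3P[-> _ qm].
exact: dvdn_trans qm mn.
Qed.

(** No weight grows from m to n, so a factor x gained at the single prime p carries over to the
    whole product. *)
Lemma defect_dvdn (R : realType) p (x : R) m n :
  (m %| n)%N -> (0 < n)%N -> prime p ->
  weight R p (logn p n) <= x * weight R p (logn p m) ->
  defect R n <= x * defect R m.
Proof.
move=> mn n0 pP wx; rewrite (defect_primes R mn n0) /defect.
have wle q : prime q ->
    0 <= weight R q (logn q n) <= weight R q (logn q m).
  move=> qP; rewrite ltW ?weight_gt0 ?prime_gt0 //=.
  by rewrite weight_nonincreasing ?prime_gt1 // dvdn_leq_log.
have [pn|pn] := boolP (p \in primes n).
  rewrite !(bigD1_seq p) ?primes_uniq //= mulrA.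
  apply: ler_pM => //.
  - by rewrite ltW ?weight_gt0 ?prime_gt0.
  - rewrite big_seq_cond; apply: prodr_ge0 => q; rewrite mem_primes.
    by case/andP=> /and3P[/wle/andP[]].
  rewrite big_seq_cond [leRHS]big_seq_cond; apply: ler_prod => q.
  by rewrite mem_primes => /andP[/and3P[/wle]].
(* If p does not divide n, both weights at p are 1 and [wx] reads 1 <= x. *)
have np : logn p n = 0%N by apply/eqP; rewrite -leqn0 leqNgt logn_gt0.
have mp : logn p m = 0%N by apply/eqP; rewrite -leqn0 -np dvdn_leq_log.
rewrite np mp weight0 mulr1 in wx.
rewrite -[leLHS]mul1r ler_pM //.
  rewrite big_seq; apply: prodr_ge0 => q; rewrite mem_primes.
  by case/and3P=> /wle/andP[].
rewrite big_seq [leRHS]big_seq; apply: ler_prod => q.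
by rewrite mem_primes => /and3P[/wle].
Qed.

Lemma mu_defect (R : realType) n : (0 < n)%N -> mu R n = ln (n%:R * defect R n).
Proof.
move=> n0; rewrite /mu -lnM ?posrE ?ltr0n; last 2 first.
- by rewrite big_seq prodn_cond_gt0 // => q; rewrite mem_primes => /and3P[/prime_gt0].
- by rewrite big_seq prodn_cond_gt0 // => q; rewrite logn_gt0.
have nE : n%:R = \prod_(q <- primes n) q%:R ^+ logn q n :> R.
  rewrite [in LHS](prod_prime_decomp n0) prime_decompE big_map natr_prod.
  by apply: eq_bigr => q _; rewrite natrX.
rewrite nE /defect !natr_prod -!big_split /=.
congr (ln _); rewrite big_seq [RHS]big_seq.
apply: eq_bigr => q qn.
have q0 : q%:R != 0 :> R.
  by move: qn; rewrite mem_primes pnatr_eq0 -lt0n => /and3P[/prime_gt0].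
move: qn; rewrite -logn_gt0; case: (logn q n) => // v _.
by rewrite weightS exprS mulrACA mulfV ?expf_neq0 // mulr1.
Qed.

(** * The quantity rho and its link to hits *)

Definition ratio (R : realType) (n : nat) : R := n%:R * defect R (2 ^ n).-1.

(** As M = 2^n - 1 is odd, the prime 2 contributes 2 * n to the exponential of mu, which is thus 2 *
    M * rho(n) < M < 2^n. *)
Lemma ratio_hit (R : realType) n : (0 < n)%N -> ratio R n < 2^-1 ->
  mu_hits R (1%N, (2 ^ n).-1, (2 ^ n)%N).
Proof.
move=> n0 rn; have M0 := predX2_gt0 n0.
have P0 : (0 < 2 ^ n)%N by rewrite expn_gt0.
split => //; first by rewrite add1n prednK.
  by rewrite gcd1n.
rewrite mul1n; set M := (2 ^ n).-1 in M0 *.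
have K0 : (0 < M * 2 ^ n)%N by rewrite muln_gt0 M0.
rewrite mu_defect // ltr_ln ?posrE ?mulr_gt0 ?defect_gt0 ?ltr0n //.
have M2 : logn 2 M = 0%N.
  apply/eqP; rewrite -leqn0 leqNgt logn_gt0 mem_primes M0 /= dvdn2.
  rewrite negbK -[odd M]negbK -[~~ odd M]/(odd M.+1) prednK //.
  by rewrite oddX negb_or -lt0n n0.
have DK : defect R (M * 2 ^ n)%N <= weight R 2 n * defect R M.
  apply: (@defect_dvdn R 2) => //; first exact: dvdn_mulr.
  by rewrite lognM // M2 add0n pfactorK // weight0 mulr1.
apply: (@le_lt_trans _ _ (M%:R * (2 * ratio R n))).
  apply: le_trans (ler_wpM2l _ DK) _ => //.
  have -> : 2 * ratio R n = (2 ^ n)%:R * (weight R 2 n * defect R M).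
    rewrite /ratio -/M mulrA [RHS]mulrA; congr (_ * _).
    case: n n0 {rn M0 P0 K0 M2 DK M} => // n _.
    by rewrite weightS natrX exprS mulrACA mulfV ?expf_neq0 ?mulr1.
  by rewrite natrM mulrA.
apply: (@lt_le_trans _ _ M%:R); last by rewrite ler_nat leq_pred.
by rewrite gtr_pMr ?ltr0n //; lra.
Qed.

(** Strong induction on p. The descent reaches primes that need not be Wieferich, so divisibility by
    p^2 is assumed only at the exponent lcm(n, p - 1). *)
Lemma halve_ratio (R : realType) p n : prime p -> (3 < p)%N -> (0 < n)%N ->
  (12 %| n)%N -> ~~ (p %| (2 ^ n).-1)%N -> (p ^ 2 %| (2 ^ lcmn n p.-1).-1)%N ->
  exists m, [/\ (0 < m)%N, (n %| m)%N & ratio R m <= ratio R n / 2].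
Proof.
elim/ltn_ind: p n => p IH n pP p3 n0 n12 pn.
set n1 := lcmn n p.-1 => pn1; set d := gcdn n p.-1.
have p1 : (0 < p.-1)%N by lia.
have n1d : (n1 * d = n * p.-1)%N by rewrite muln_lcm_gcd.
have n10 : (0 < n1)%N by rewrite lcmn_gt0 n0.
have nn1 : (n %| n1)%N by rewrite dvdn_lcml.
have p1n1 : (p.-1 %| n1)%N by rewrite dvdn_lcmr.
have M0 := predX2_gt0 n0; have M10 := predX2_gt0 n10.
have MM1 := dvdn_predX2 nn1.
have podd : odd p by case: (even_prime pP) => // p2; rewrite p2 in p3.
have ppos : 0 < p%:R :> R by rewrite ltr0n prime_gt0.
have D0 := defect_gt0 R (2 ^ n).-1.
have pM : logn p (2 ^ n).-1 = 0%N.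
  by apply/eqP; rewrite -leqn0 leqNgt logn_gt0 mem_primes pP M0.
have D1 : defect R (2 ^ n1).-1 <= 2 / p%:R * defect R (2 ^ n).-1.
  apply: (@defect_dvdn R p) => //.
  by rewrite pM weight0 mulr1 weight_ge2 ?(prime_gt1 pP) // -pfactor_dvdn.
have d2 : (2 %| d)%N.
  rewrite dvdn_gcd (dvdn_trans _ n12) //= dvdn2.
  by rewrite -[p]prednK ?prime_gt0 //= in podd.
have [dE|dE] := eqVneq d 2%N; last first.
  exists n1; split => //.
  (* d is even, not 2, and nonzero because n1 * d = n * (p - 1) > 0. *)
  have d4 : (4 <= d)%N.
    by case/dvdnP: d2 dE n1d => -[|[|k]] -> // _; nia.
  have n14 : (n1%:R * 4 <= n%:R * p%:R :> R).
    rewrite -!natrM ler_nat; apply: (@leq_trans (n1 * d)%N).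
      by rewrite leq_mul2l d4 orbT.
    by rewrite n1d leq_mul2l leq_pred orbT.
  rewrite /ratio; apply: le_trans (ler_wpM2l (ler0n _ _) D1) _.
  rewrite !mulrA [leRHS]mulrAC ler_pM2r // ler_pdivrMr //.
  by lra.
(* Since 12 divides n and d = 2, neither 4 nor 3 divides p - 1, so the least prime factor of (p - 1)
   / 2 exceeds 3. *)
have [q [qP q3 qp]] : exists q, [/\ prime q, (3 < q)%N & (q %| p.-1)%N].
  have q_dvd r : (r %| n)%N -> (r %| p.-1)%N -> (r <= 2)%N.
    by move=> rn rp; rewrite dvdn_leq // -dE dvdn_gcd rn.
  have [u pE] : exists u, p.-1 = (u * 2)%N.
    by apply/dvdnP; apply: dvdn_trans d2 (dvdn_gcdr _ _).
  have u1 : (1 < u)%N by lia.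
  have qu := pdiv_dvd u; have qP := pdiv_prime u1.
  exists (pdiv u); split => //; last by rewrite pE dvdn_mulr.
  rewrite ltnNge; apply/negP => q3.
  have [q2|q2] : pdiv u = 2%N \/ pdiv u = 3%N by have := prime_gt1 qP; lia.
    suff : (4 <= 2)%N by [].
    apply: q_dvd; first exact: dvdn_trans n12.
    by rewrite pE -[4%N]/(2 * 2)%N dvdn_pmul2r // -[X in (X %| _)%N]q2.
  suff : (3 <= 2)%N by [].
  apply: q_dvd; first exact: dvdn_trans n12.
  by rewrite pE dvdn_mulr // -[X in (X %| _)%N]q2.
have qn : coprime q n.
  rewrite prime_coprime //; apply/negP => qn.
  have : (q %| d)%N by rewrite dvdn_gcd qn.
  by rewrite dE => /dvdn_leq -/(_ isT); lia.
(* The growth n1 / n = (p - 1) / 2 is offset by the saving 2 / p, so rho(n1) <= rho(n); the factor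
   1/2 has to come from q. *)
have n12' : (n1%:R * 2 <= n%:R * p%:R :> R).
  have : (n1 * 2 = n * p.-1)%N by rewrite -n1d dE.
  by rewrite -!natrM ler_nat => ->; rewrite leq_mul2l leq_pred orbT.
have qn1 : (q %| n1)%N by exact: dvdn_trans p1n1.
have qltp : (q < p)%N by rewrite -(prednK (prime_gt0 pP)) ltnS dvdn_leq.
have qpos : 0 < q%:R :> R by rewrite ltr0n prime_gt0.
have [qM|qM] := boolP (q %| (2 ^ n1).-1)%N; last first.
  have [||||||m [m0 n1m rm]] := IH q qltp n1 => //.
  - exact: dvdn_trans nn1.
  (* Lifting with m = 1: q divides the exponent and, by Fermat, also the number itself. *)
  - have qo : odd q by case: (even_prime qP) => // q2'; rewrite q2' in q3.
    have qf := fermat_predX2 qP qo (dvdn_lcmr n1 q.-1).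
    have ql : (q %| lcmn n1 q.-1)%N by apply: dvdn_trans qn1 (dvdn_lcml _ _).
    by have [] := prime_dvd_predX2_lift qP (coprimen1 q) (dvd1n _) ql qf.
  exists m; split => //; first exact: dvdn_trans n1m.
  apply: le_trans rm _; rewrite ler_pM2r ?invr_gt0 //.
  rewrite /ratio; apply: le_trans (ler_wpM2l (ler0n _ _) D1) _.
  by rewrite !mulrA ler_pM2r // ler_pdivrMr.
have [q2M qMM] := prime_dvd_predX2_lift qP qn nn1 qn1 qM.
exists n1; split => //.
(* The intermediate number (2^n - 1) * p^2 separates the two savings: first the one at p, then the
   one at q. *)
have pM' : coprime (2 ^ n).-1 (p ^ 2) by rewrite coprimeXr // coprime_sym prime_coprime.
have m_dvd : ((2 ^ n).-1 * p ^ 2 %| (2 ^ n1).-1)%N by rewrite Gauss_dvd ?MM1.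
have P0 : (0 < p ^ 2)%N by rewrite expn_gt0 prime_gt0.
have m0 : (0 < (2 ^ n).-1 * p ^ 2)%N by rewrite muln_gt0 M0.
have Dm : defect R ((2 ^ n).-1 * p ^ 2)%N <= 2 / p%:R * defect R (2 ^ n).-1.
  apply: (@defect_dvdn R p) => //; first exact: dvdn_mulr.
  by rewrite lognM // pM weight0 mulr1 pfactorK // weight_ge2 ?(prime_gt1 pP).
have Dq : defect R (2 ^ n1).-1 <= 2 / q%:R * defect R ((2 ^ n).-1 * p ^ 2)%N.
  apply: (@defect_dvdn R q) => //; apply: weight_succ.
  - exact: prime_gt1.
  - by rewrite -pfactor_dvdn.
  rewrite lognM // lognX (logn_prime _ pP) (ltn_eqF qltp) muln0 addn0.
  apply: leq_trans (dvdn_leq_log q M10 qMM).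
  by rewrite lognM ?(prime_gt0 qP) // (logn_prime _ qP) eqxx addn1.
rewrite /ratio; apply: le_trans (ler_wpM2l (ler0n _ _) Dq) _.
have q4 : 4 <= q%:R :> R by rewrite ler_nat.
apply: (@le_trans _ _ (n1%:R * (2^-1 * (2 / p%:R * defect R (2 ^ n).-1)))).
  apply: ler_wpM2l => //; apply: ler_pM => //.
  - exact/ltW/defect_gt0.
  - by rewrite ler_pdivrMr //; lra.
rewrite !mulrA [leRHS]mulrAC ler_pM2r // ler_pdivrMr //; lra.
Qed.

Theorem theorem3 (R : realType) :
  infinite_set wieferich -> infinite_set (mu_hits R).
Proof.
move=> winf hfin.
have wlarge N : exists2 p, wieferich p & (N < p)%N.
  apply: contrapT => noW; apply: winf.
  apply: sub_finite_set (finite_II N.+1) => p Wp /=.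
  by rewrite ltnS leqNgt; apply/negP => Np; apply: noW; exists p.
have halve n : (0 < n)%N -> (12 %| n)%N ->
    exists m, [/\ (0 < m)%N, (n %| m)%N & ratio R m <= ratio R n / 2].
  (* p > 2^n ensures both p > 3 and that p does not divide 2^n - 1. *)
  move=> n0 n12; have [p [pP pW] np] := wlarge (2 ^ n)%N.
  apply: (@halve_ratio R p) => //.
  - apply: leq_ltn_trans np; apply: leq_trans (ltn_expl _ _) => //.
    by move/dvdn_leq: n12 => /(_ n0); lia.
  - by apply/negP => /dvdn_leq -/(_ (predX2_gt0 n0)); lia.
  - by rewrite (dvdn_trans _ (dvdn_predX2 (dvdn_lcmr _ _))) // -!subn1.
have iter k n : (0 < n)%N -> (12 %| n)%N ->
    exists m, [/\ (0 < m)%N, (n %| m)%N & ratio R m <= ratio R n / 2 ^+ k].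
  elim: k n => [|k IHk] n n0 n12; first by exists n; split; rewrite ?divr1.
  have [m [m0 nm rm]] := halve n n0 n12.
  have [l [l0 ml rl]] := IHk m m0 (dvdn_trans n12 nm).
  exists l; split; rewrite ?(dvdn_trans nm) //; apply: le_trans rl _.
  by rewrite exprS invfM mulrA ler_pM2r // invr_gt0 exprn_gt0.
have hits N : exists2 t, mu_hits R t & (N < t.2)%N.
  (* Any positive multiple m of this n has 2^m > N. The number k of halvings is chosen with 2 *
     rho(n) < 2^k. *)
  pose n := (12 * N.+1)%N; have n12 : (12 %| n)%N by rewrite dvdn_mulr.
  have [m [m0 Nm rm]] := iter (Num.bound (2 * ratio R n)) n isT n12.
  exists (1%N, (2 ^ m).-1, (2 ^ m)%N).
    apply: ratio_hit => //; apply: le_lt_trans rm _.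
    rewrite ltr_pdivrMr ?exprn_gt0 // -ltr_pdivrMl ?invr_gt0 // invrK.
    exact: upper_nthrootP.
  apply: leq_trans (ltnW (ltn_expl _ _)) => //.
  by move/dvdn_leq: Nm => /(_ m0); lia.
have [X XE] := finite_fsetP.1 hfin.
have [t] := hits (\max_(t <- finmap.enum_fset X) t.2)%N.
rewrite XE /= => tX; rewrite ltnNge => /negP; apply.
exact: (@leq_bigmax_seq _ _ xpredT (fun t => t.2)).
Qed.
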